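(* Consider a system of two real second-order ODEs $$f''=w_1(x,f,g,f',g'),\qquad g''=w_2(x,f,g,f',g'),$$ which corresponds via $u=f+ig$ to an r-CODE $u''=w(x,u,u')$ with complex Lagrangian $L(x,u,u')=L_1+iL_2$, where $L_1,L_2$ are real-valued. If $\mathbf{X}_1$ and $\mathbf{X}_2$, with coefficient functions $\varsigma_1,\varsigma_2,\chi_1,\chi_2$, are two Noether-like operators of the system with respect to the Lagrangians $L_1$ and $L_2$, with gauge functions $A_1,A_2$, then the system admits the two first integrals $$I_1=\varsigma_1L_1-\varsigma_2L_2+\frac{\partial L_1}{\partial f'}\left(\chi_1-f'\varsigma_1+g'\varsigma_2\right)-\frac{\partial L_2}{\partial f'}\left(\chi_2-f'\varsigma_2-g'\varsigma_1\right)-A_1,$$ $$I_2=\varsigma_1L_2+\varsigma_2L_1+\frac{\partial L_2}{\partial f'}\left(\chi_1-f'\varsigma_1+g'\varsigma_2\right)+\frac{\partial L_1}{\partial f'}\left(\chi_2-f'\varsigma_2-g'\varsigma_1\right)-A_2,$$ that is, $\dfrac{dI_1}{dx}=0$ and $\dfrac{dI_2}{dx}=0$ along every solution of the system.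
   Context: An r-CODE (restricted complex ODE) is an ODE $u''=w(x,u,u')$ for a complex-valued function $u$ of one real variable $x$; writing $u=f+ig$ with $f,g$ real and $w=w_1+iw_2$ gives the corresponding real system for $(f,g)$. A complex Lagrangian of the r-CODE is a complex-valued function $L(x,u,u')$, smooth in real $x$ and complex analytic in $u$ and $u'$, whose Euler-Lagrange equation $\frac{\partial L}{\partial u}-\frac{d}{dx}\left(\frac{\partial L}{\partial u'}\right)=0$ (complex derivatives in $u,u'$) is equivalent to the r-CODE. Its real and imaginary parts $L_1,L_2$ are regarded as functions of $(x,f,g,f',g')$, with $u=f+ig$, $u'=f'+ig'$. Let $d_x=d/dx$ denote the total derivative with respect to $x$. Let $\varsigma_1,\varsigma_2,\chi_1,\chi_2$ be smooth real functions of $(x,f,g)$. The operators $$\mathbf{X}_1=\varsigma_1\partial_x+\tfrac12\left(\chi_1\partial_f+\chi_2\partial_g\right),\qquad \mathbf{X}_2=\varsigma_2\partial_x+\tfrac12\left(\chi_2\partial_f-\chi_1\partial_g\right)$$ are the real and imaginary parts of the complex operator $\mathbf{Z}=\mathbf{X}_1+i\mathbf{X}_2=\varsigma\,\partial_x+\chi\,\partial_u$, where $\varsigma=\varsigma_1+i\varsigma_2$, $\chi=\chi_1+i\chi_2$ and $\partial_u=\tfrac12(\partial_f-i\partial_g)$. Their first prolongations are $$\mathbf{X}_1^{(1)}=\mathbf{X}_1+\tfrac12\left(\chi_1^{(1)}\partial_{f'}+\chi_2^{(1)}\partial_{g'}\right),\qquad \mathbf{X}_2^{(1)}=\mathbf{X}_2+\tfrac12\left(\chi_2^{(1)}\partial_{f'}-\chi_1^{(1)}\partial_{g'}\right),$$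 where $\chi_1^{(1)}+i\chi_2^{(1)}=\chi^{(1)}=d_x\chi-u'\,d_x\varsigma$, i.e. $$\chi_1^{(1)}=d_x\chi_1-f'd_x\varsigma_1+g'd_x\varsigma_2,\qquad \chi_2^{(1)}=d_x\chi_2-f'd_x\varsigma_2-g'd_x\varsigma_1 .$$ $\mathbf{X}_1,\mathbf{X}_2$ are called Noether-like operators of the system with respect to $L_1$ and $L_2$ if there are real (gauge) functions $A_1,A_2$ of $(x,f,g)$ such that $$\mathbf{X}_1^{(1)}L_1-\mathbf{X}_2^{(1)}L_2+(d_x\varsigma_1)L_1-(d_x\varsigma_2)L_2=d_xA_1,$$ $$\mathbf{X}_1^{(1)}L_2+\mathbf{X}_2^{(1)}L_1+(d_x\varsigma_1)L_2+(d_x\varsigma_2)L_1=d_xA_2$$ hold identically in $(x,f,g,f',g')$. A first integral of the system is a function of $(x,f,g,f',g')$ whose total $x$-derivative vanishes on solutions of the system. *)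

(* Defs.v *)
(* Stdlib reals with Coquelicot.

   Conventions.  A point of the first jet space is (x, u, u') : R * C * C; as
   Coquelicot's C is R * R with (f, g) = f + i g, it is also (x, (f, g), (f', g')).
   In real formulas f' and g' are written p and q. *)
From Stdlib Require Import Reals.
From Coquelicot Require Import Coquelicot.
Open Scope R_scope.

Definition base_fun := R -> R -> R -> R.
Definition jet_fun := R -> R -> R -> R -> R -> R.
Definition complex_jet_fun := R -> C -> C -> C.

Definition re_part (F : complex_jet_fun) : jet_fun :=
  fun x f g p q => Re (F x (f, g) (p, q)).
Definition im_part (F : complex_jet_fun) : jet_fun :=
  fun x f g p q => Im (F x (f, g) (p, q)).

Definition on_jets (F : jet_fun) : R * C * C -> R :=
  fun j => let '(x, u, v) := j in F x (Re u) (Im u) (Re v) (Im v).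
Definition on_base (a : base_fun) : R * C -> R :=
  fun y => let '(x, u) := y in a x (Re u) (Im u).

Definition base_of (Omega : R * C * C -> Prop) : R * C -> Prop :=
  fun y => exists v : C, Omega (y, v).

(* Class C^n on D, meant for D open in a finite-dimensional V: F is
   differentiable and all its directional derivatives are of class C^(n-1). *)
Fixpoint class_Cn (n : nat) {V : NormedModule R_AbsRing}
    (D : V -> Prop) (F : V -> R) : Prop :=
  match n with
  | O => forall y, D y -> continuous F y
  | S m => (forall y, D y -> ex_filterdiff F (locally y)) /\
      forall h : V, class_Cn m D (fun y => Derive (fun t => F (plus y (scal t h))) 0)
  end.

Definition smooth {V : NormedModule R_AbsRing} (D : V -> Prop) (F : V -> R) : Prop :=
  forall n, class_Cn n D F.

(* Partial derivatives of a function of (x, f, g, f', g'). *)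
Definition d_dx (F : jet_fun) : jet_fun := fun x f g p q => Derive (fun s => F s f g p q) x.
Definition d_df (F : jet_fun) : jet_fun := fun x f g p q => Derive (fun s => F x s g p q) f.
Definition d_dg (F : jet_fun) : jet_fun := fun x f g p q => Derive (fun s => F x f s p q) g.
Definition d_dp (F : jet_fun) : jet_fun := fun x f g p q => Derive (fun s => F x f g s q) p.
Definition d_dq (F : jet_fun) : jet_fun := fun x f g p q => Derive (fun s => F x f g p s) q.

(* Total derivative d_x of a function of (x, f, g). *)
Definition total_d (a : base_fun) : jet_fun := fun x f g p q =>
  Derive (fun s => a s f g) x + p * Derive (fun s => a x s g) f
  + q * Derive (fun s => a x f s) g.

(* Derivative of a complex-valued function of a real variable. *)
Definition deriv_RC (u : R -> C) (x : R) : C :=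
  (Derive (fun t => Re (u t)) x, Derive (fun t => Im (u t)) x).

Definition in_interval (a b : Rbar) (x : R) : Prop := Rbar_lt a x /\ Rbar_lt x b.

(* A twice differentiable curve on (a, b) whose first jet stays in Omega. *)
Definition admissible (Omega : R * C * C -> Prop) (a b : Rbar) (f g : R -> R) : Prop :=
  forall x, in_interval a b x ->
    ex_derive f x /\ ex_derive g x /\
    ex_derive (Derive f) x /\ ex_derive (Derive g) x /\
    Omega (x, (f x, g x), (Derive f x, Derive g x)).

Definition solves_rCODE (w : complex_jet_fun) (a b : Rbar) (u : R -> C) : Prop :=
  forall x, in_interval a b x -> deriv_RC (deriv_RC u) x = w x (u x) (deriv_RC u x).

Definition solves_system (w1 w2 : jet_fun) (a b : Rbar) (f g : R -> R) : Prop :=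
  forall x, in_interval a b x ->
    Derive (Derive f) x = w1 x (f x) (g x) (Derive f x) (Derive g x) /\
    Derive (Derive g) x = w2 x (f x) (g x) (Derive f x) (Derive g x).

Definition L_u (L : complex_jet_fun) : complex_jet_fun :=
  fun x u v => C_derive (fun z => L x z v) u.
Definition L_u' (L : complex_jet_fun) : complex_jet_fun :=
  fun x u v => C_derive (fun z => L x u z) v.

Definition solves_EL (L : complex_jet_fun) (a b : Rbar) (u : R -> C) : Prop :=
  forall x, in_interval a b x ->
    Cminus (L_u L x (u x) (deriv_RC u x))
           (deriv_RC (fun t => L_u' L t (u t) (deriv_RC u t)) x) = RtoC 0.

(* Together with joint smoothness, complex differentiability in u and in u' on
   the open set Omega is complex analyticity in (u, u'). *)
Definition complex_analytic (Omega : R * C * C -> Prop) (L : complex_jet_fun) : Prop :=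
  forall (x : R) (u v : C), Omega (x, u, v) ->
    ex_derive (K := C_AbsRing) (V := C_NormedModule) (fun z => L x z v) u /\
    ex_derive (K := C_AbsRing) (V := C_NormedModule) (fun z => L x u z) v.

Definition complex_Lagrangian (Omega : R * C * C -> Prop) (w L : complex_jet_fun) : Prop :=
  smooth Omega (on_jets (re_part L)) /\
  smooth Omega (on_jets (im_part L)) /\
  complex_analytic Omega L /\
  forall (a b : Rbar) (u : R -> C),
    admissible Omega a b (fun t => Re (u t)) (fun t => Im (u t)) ->
    (solves_EL L a b u <-> solves_rCODE w a b u).

Definition chi1_prol (s1 s2 c1 : base_fun) : jet_fun := fun x f g p q =>
  total_d c1 x f g p q - p * total_d s1 x f g p q + q * total_d s2 x f g p q.
Definition chi2_prol (s1 s2 c2 : base_fun) : jet_fun := fun x f g p q =>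
  total_d c2 x f g p q - p * total_d s2 x f g p q - q * total_d s1 x f g p q.

(* The first prolongations X_1^(1) and X_2^(1), applied to F. *)
Definition X1_prol (s1 s2 c1 c2 : base_fun) (F : jet_fun) : jet_fun := fun x f g p q =>
  s1 x f g * d_dx F x f g p q
  + 1 / 2 * (c1 x f g * d_df F x f g p q + c2 x f g * d_dg F x f g p q)
  + 1 / 2 * (chi1_prol s1 s2 c1 x f g p q * d_dp F x f g p q
             + chi2_prol s1 s2 c2 x f g p q * d_dq F x f g p q).
Definition X2_prol (s1 s2 c1 c2 : base_fun) (F : jet_fun) : jet_fun := fun x f g p q =>
  s2 x f g * d_dx F x f g p q
  + 1 / 2 * (c2 x f g * d_df F x f g p q - c1 x f g * d_dg F x f g p q)
  + 1 / 2 * (chi2_prol s1 s2 c2 x f g p q * d_dp F x f g p q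
             - chi1_prol s1 s2 c1 x f g p q * d_dq F x f g p q).

(* Of the gauge functions only differentiability is required: it is what gives
   d_x A_1 and d_x A_2 a meaning. *)
Definition Noether_like (Omega : R * C * C -> Prop) (L1 L2 : jet_fun)
    (s1 s2 c1 c2 A1 A2 : base_fun) : Prop :=
  smooth (base_of Omega) (on_base s1) /\ smooth (base_of Omega) (on_base s2) /\
  smooth (base_of Omega) (on_base c1) /\ smooth (base_of Omega) (on_base c2) /\
  (forall y, base_of Omega y -> ex_filterdiff (on_base A1) (locally y)) /\
  (forall y, base_of Omega y -> ex_filterdiff (on_base A2) (locally y)) /\
  forall x f g p q, Omega (x, (f, g), (p, q)) ->
    X1_prol s1 s2 c1 c2 L1 x f g p q - X2_prol s1 s2 c1 c2 L2 x f g p q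
      + total_d s1 x f g p q * L1 x f g p q - total_d s2 x f g p q * L2 x f g p q
      = total_d A1 x f g p q /\
    X1_prol s1 s2 c1 c2 L2 x f g p q + X2_prol s1 s2 c1 c2 L1 x f g p q
      + total_d s1 x f g p q * L2 x f g p q + total_d s2 x f g p q * L1 x f g p q
      = total_d A2 x f g p q.

Definition first_integral (Omega : R * C * C -> Prop) (w1 w2 I : jet_fun) : Prop :=
  forall (a b : Rbar) (f g : R -> R),
    admissible Omega a b f g -> solves_system w1 w2 a b f g ->
    forall x, in_interval a b x ->
      is_derive (fun t => I t (f t) (g t) (Derive f t) (Derive g t)) x 0.

Definition noether_I1 (L1 L2 : jet_fun) (s1 s2 c1 c2 A1 : base_fun) : jet_fun :=
  fun x f g p q =>
  s1 x f g * L1 x f g p q - s2 x f g * L2 x f g p q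
  + d_dp L1 x f g p q * (c1 x f g - p * s1 x f g + q * s2 x f g)
  - d_dp L2 x f g p q * (c2 x f g - p * s2 x f g - q * s1 x f g)
  - A1 x f g.
Definition noether_I2 (L1 L2 : jet_fun) (s1 s2 c1 c2 A2 : base_fun) : jet_fun :=
  fun x f g p q =>
  s1 x f g * L2 x f g p q + s2 x f g * L1 x f g p q
  + d_dp L2 x f g p q * (c1 x f g - p * s1 x f g + q * s2 x f g)
  + d_dp L1 x f g p q * (c2 x f g - p * s2 x f g - q * s1 x f g)
  - A2 x f g.

(* Main.v *)
Require Import Defs.
From Stdlib Require Import Reals Lra FunctionalExtensionality.
From Coquelicot Require Import Coquelicot.
Open Scope R_scope.

(** The two expressions are the real and imaginary parts of the classical
    Noether integral I = s L + L_u' (c - u' s) - A, where s = s1 + i s2,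
    c = c1 + i c2 and A = A1 + i A2.  Along a curve u(x),
      dI/dx = s' L + s (L_x + u' L_u + u'' L_u') + (L_u')' (c - u' s)
              + L_u' (c' - u'' s - u' s') - A',
    with primes on s, c, A and L_u' for the derivative along the curve.  The
    terms in u'' cancel, and the Euler-Lagrange equation (L_u')' = L_u turns
    the rest into s L_x + c L_u + (c' - u' s') L_u' + s' L - A', which the
    Noether condition makes zero.

    The hypotheses are about real partial derivatives, and the passage to this
    complex computation is the Cauchy-Riemann system (cauchy_riemann), used in
    u and in u'.  It gives L_u = d_f L1 + i d_f L2 and L_u' = d_f' L1 + i d_f' L2,
    so that a solution of the real system satisfies (d_f' L_k)' = d_f L_k for
    k = 1, 2 (real_Euler_Lagrange).  It also eliminates the derivatives in g and
    g' from the chain rule and from the prolonged operators, for instance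
      1/2 (c1 d_f + c2 d_g) L1 - 1/2 (c2 d_f - c1 d_g) L2 = c1 d_f L1 - c2 d_f L2,
    which is Re (c L_u).  The theorem is then an identity of polynomials. *)

(** * Derivatives along curves *)

(** Multiplication by the complex derivative is R-linear, and the modulus is the
    norm of C over R, so the same estimate expresses both differentiabilities. *)
Lemma ex_derive_C_filterdiff_R (F : C -> C) (z : C) :
  ex_derive (K := C_AbsRing) (V := C_NormedModule) F z ->
  filterdiff (K := R_AbsRing) (U := C_R_NormedModule) (V := C_R_NormedModule)
    F (locally z) (fun h => Cmult h (C_derive F z)).
Proof.
  intros [l Hl].
  rewrite (is_C_derive_unique _ _ _ Hl).
  destruct Hl as [_ Hl].
  split.
  - constructor.
    + intros x y. exact (Cmult_plus_distr_r x y l).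
    + intros k [a b]. apply injective_projections; simpl;
        unfold scal, mult; simpl; unfold mult; simpl; ring.
    + exists (Cmod l + 1); split.
      * generalize (Cmod_ge_0 l); lra.
      * intros x. rewrite <- !Cmod_norm, Cmod_mult.
        generalize (Cmod_ge_0 l) (Cmod_ge_0 x); nra.
  - intros x Hx eps.
    (* locally_C: disks and squares define the same neighbourhoods. *)
    apply (is_filter_lim_locally_unique (V := C_R_NormedModule)) in Hx; subst x.
    generalize (proj2 (locally_C z _) (Hl z (fun P HP => HP) eps)).
    apply filter_imp; intros y Hy.
    rewrite <- !Cmod_norm. exact Hy.
Qed.

(** Directional derivatives at y are taken at 0 of a translated function; this
    turns them into partial derivatives, even where these do not exist. *)
Lemma Derive_shift (G : R -> R) (p : R) :
  Derive (fun t => G (p + t)) 0 = Derive G p.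
Proof.
  unfold Derive. f_equal. apply Lim_ext; intros h.
  rewrite Rplus_0_r, Rplus_0_l. reflexivity.
Qed.

Lemma is_derive_pair {U V : NormedModule R_AbsRing} (a : R -> U) (b : R -> V) t da db :
  is_derive a t da -> is_derive b t db ->
  is_derive (V := prod_NormedModule R_AbsRing U V) (fun s => (a s, b s)) t (da, db).
Proof.
  intros Ha Hb.
  refine (filterdiff_comp'_2 a b (fun x y => (x, y)) t _ _ (fun x y => (x, y)) Ha Hb _).
  apply filterdiff_linear.
  apply is_linear_prod; [apply is_linear_fst | apply is_linear_snd].
Qed.

Lemma is_derive_filterdiff_comp {U V : NormedModule R_AbsRing} (F : U -> V) (l : U -> V)
    (c : R -> U) t dc :
  filterdiff F (locally (c t)) l -> is_derive c t dc ->
  is_derive (fun s => F (c s)) t (l dc).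
Proof.
  intros HF Hc.
  apply (filterdiff_ext_lin _ _ _ (filterdiff_comp' c F t _ l Hc HF)); intros y.
  exact (linear_scal _ (proj1 HF) y dc).
Qed.

Lemma is_derive_along_jet (F : jet_fun) (f g p q : R -> R) (t df dg dp dq : R) :
  ex_filterdiff (on_jets F) (locally (t, (f t, g t), (p t, q t))) ->
  is_derive f t df -> is_derive g t dg -> is_derive p t dp -> is_derive q t dq ->
  is_derive (fun s => F s (f s) (g s) (p s) (q s)) t
    (d_dx F t (f t) (g t) (p t) (q t) + df * d_df F t (f t) (g t) (p t) (q t)
     + dg * d_dg F t (f t) (g t) (p t) (q t) + dp * d_dp F t (f t) (g t) (p t) (q t)
     + dq * d_dq F t (f t) (g t) (p t) (q t)).
Proof.
  intros [l HF] Hf Hg Hp Hq.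
  assert (Hl := is_derive_filterdiff_comp (on_jets F) l).
  assert (Hc : forall a : R, forall s : R, is_derive (fun _ => a) s 0)
    by (intros a s; exact (is_derive_const a s)).
  assert (Hid : forall s : R, is_derive (fun s => s) s 1)
    by (intros s; exact (is_derive_id s)).
  (* Each partial derivative is the value of the differential on a basis vector:
     the chain rule for the corresponding coordinate line. *)
  replace (d_dx F t (f t) (g t) (p t) (q t)) with (l (1, (0, 0), (0, 0))).
  2: { symmetry; apply is_derive_unique.
       refine (Hl (fun s => (s, (f t, g t), (p t, q t))) t _ HF _).
       repeat apply is_derive_pair; auto. }
  replace (d_df F t (f t) (g t) (p t) (q t)) with (l (0, (1, 0), (0, 0))).
  2: { symmetry; apply is_derive_unique.
       refine (Hl (fun s => (t, (s, g t), (p t, q t))) (f t) _ HF _).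
       repeat apply is_derive_pair; auto. }
  replace (d_dg F t (f t) (g t) (p t) (q t)) with (l (0, (0, 1), (0, 0))).
  2: { symmetry; apply is_derive_unique.
       refine (Hl (fun s => (t, (f t, s), (p t, q t))) (g t) _ HF _).
       repeat apply is_derive_pair; auto. }
  replace (d_dp F t (f t) (g t) (p t) (q t)) with (l (0, (0, 0), (1, 0))).
  2: { symmetry; apply is_derive_unique.
       refine (Hl (fun s => (t, (f t, g t), (s, q t))) (p t) _ HF _).
       repeat apply is_derive_pair; auto. }
  replace (d_dq F t (f t) (g t) (p t) (q t)) with (l (0, (0, 0), (0, 1))).
  2: { symmetry; apply is_derive_unique.
       refine (Hl (fun s => (t, (f t, g t), (p t, s))) (q t) _ HF _).
       repeat apply is_derive_pair; auto. }
  match goal with |- is_derive _ _ ?d =>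
    replace d with (l (1, (df, dg), (dp, dq)))
  end.
  - refine (Hl (fun s => (s, (f s, g s), (p s, q s))) t _ HF _).
    repeat apply is_derive_pair; auto.
  - destruct HF as [Hlin _].
    assert (Hs : forall k y, k * l y = l (scal k y))
      by (intros k y; symmetry; exact (linear_scal l Hlin k y)).
    assert (Hp' : forall y z, l y + l z = l (plus y z))
      by (intros y z; symmetry; exact (linear_plus l Hlin y z)).
    rewrite !Hs, !Hp'. f_equal.
    repeat apply injective_projections; simpl;
      unfold plus, scal; simpl; unfold mult; simpl;
      match goal with |- ?a = ?b => change (@eq R a b) end; ring.
Qed.

(** A function of (x, f, g) is a function on jets that ignores (f', g'), so any
    value of the latter, here 0, serves to apply the chain rule on jets. *)
Lemma is_derive_along_base (a : base_fun) (f g : R -> R) (t df dg : R) :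
  ex_filterdiff (on_base a) (locally (t, (f t, g t))) ->
  is_derive f t df -> is_derive g t dg ->
  is_derive (fun s => a s (f s) (g s)) t (total_d a t (f t) (g t) df dg).
Proof.
  intros [l HF] Hf Hg.
  assert (HJ : ex_filterdiff (on_jets (fun x f g _ _ => a x f g))
     (locally (t, (f t, g t), (0, 0)))).
  { apply ex_filterdiff_ext with (fun j : R * C * C => on_base a (fst j)).
    { intros [[x u] v]. reflexivity. }
    exists (fun j : R * C * C => l (fst j)).
    refine (filterdiff_comp' fst (on_base a) (t, (f t, g t), (0, 0)) fst l _ HF).
    apply filterdiff_linear, is_linear_fst. }
  assert (H := is_derive_along_jet _ f g (fun _ => 0) (fun _ => 0) t df dg 0 0 HJ Hf Hg
    (is_derive_const _ _) (is_derive_const _ _)).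
  refine (eq_ind _ _ H _ _).
  unfold total_d, d_dx, d_df, d_dg. ring.
Qed.

(** * Complex analyticity and the Euler-Lagrange equation *)

(** The differential of F is multiplication by F'(z) = a + i b: it sends the real
    direction to (a, b) and the imaginary one to (-b, a). *)
Lemma cauchy_riemann (F : C -> C) f g :
  ex_derive (K := C_AbsRing) (V := C_NormedModule) F (f, g) ->
  C_derive F (f, g) = (Derive (fun s => Re (F (s, g))) f, Derive (fun s => Im (F (s, g))) f) /\
  Derive (fun s => Re (F (f, s))) g = - Derive (fun s => Im (F (s, g))) f /\
  Derive (fun s => Im (F (f, s))) g = Derive (fun s => Re (F (s, g))) f.
Proof.
  intros HF. apply ex_derive_C_filterdiff_R in HF.
  destruct (C_derive F (f, g)) as [lr li].
  assert (HD : forall (c : R -> C) (t : R) (dc : C), c t = (f, g) ->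
    is_derive (V := C_R_NormedModule) c t dc ->
    Derive (fun s => Re (F (c s))) t = Re (Cmult dc (lr, li)) /\
    Derive (fun s => Im (F (c s))) t = Im (Cmult dc (lr, li))).
  { intros c t dc Hct Hc. rewrite <- Hct in HF.
    assert (HFc := is_derive_filterdiff_comp F _ c t dc HF Hc).
    split; apply is_derive_unique.
    - refine (is_derive_filterdiff_comp Re Re _ t _ _ HFc).
      apply filterdiff_linear, is_linear_fst.
    - refine (is_derive_filterdiff_comp Im Im _ t _ _ HFc).
      apply filterdiff_linear, is_linear_snd. }
  destruct (HD (fun s => (s, g)) f (1, 0) eq_refl) as [-> ->].
  { exact (is_derive_pair _ _ f 1 0 (is_derive_id f) (is_derive_const g f)). }
  destruct (HD (fun s => (f, s)) g (0, 1) eq_refl) as [-> ->].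
  { exact (is_derive_pair _ _ g 0 1 (is_derive_const f g) (is_derive_id g)). }
  unfold Re, Im; simpl.
  split; [apply injective_projections; simpl | split]; ring.
Qed.

Lemma smooth_ex_filterdiff {V : NormedModule R_AbsRing} (D : V -> Prop) (F : V -> R) y :
  smooth D F -> D y -> ex_filterdiff F (locally y).
Proof. intros HF Hy. exact (proj1 (HF 1%nat) y Hy). Qed.

(** This is where class C^2 of the Lagrangian enters: the momenta d_f' L1 and
    d_f' L2 have to be differentiable along solutions. *)
Lemma smooth_d_dp (Omega : R * C * C -> Prop) (F : jet_fun) j :
  smooth Omega (on_jets F) -> Omega j -> ex_filterdiff (on_jets (d_dp F)) (locally j).
Proof.
  intros HF Hj.
  generalize (proj1 (proj2 (HF 2%nat) (0, (0, 0), (1, 0))) j Hj).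
  apply ex_filterdiff_ext. intros [[x [f g]] [p q]].
  unfold d_dp. simpl. rewrite <- (Derive_shift (fun s => F x f g s q) p).
  apply Derive_ext; intros t.
  unfold plus, scal; simpl. unfold plus, scal; simpl; unfold mult; simpl.
  f_equal; ring.
Qed.

Lemma L_u'_partials Omega L x f g p q :
  complex_analytic Omega L -> Omega (x, (f, g), (p, q)) ->
  L_u' L x (f, g) (p, q) =
    (d_dp (re_part L) x f g p q, d_dp (im_part L) x f g p q) /\
  d_dq (re_part L) x f g p q = - d_dp (im_part L) x f g p q /\
  d_dq (im_part L) x f g p q = d_dp (re_part L) x f g p q.
Proof.
  intros HL Hj. exact (cauchy_riemann (fun z => L x (f, g) z) p q (proj2 (HL x _ _ Hj))).
Qed.

Lemma L_u_partials Omega L x f g p q :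
  complex_analytic Omega L -> Omega (x, (f, g), (p, q)) ->
  L_u L x (f, g) (p, q) =
    (d_df (re_part L) x f g p q, d_df (im_part L) x f g p q) /\
  d_dg (re_part L) x f g p q = - d_df (im_part L) x f g p q /\
  d_dg (im_part L) x f g p q = d_df (re_part L) x f g p q.
Proof.
  intros HL Hj. exact (cauchy_riemann (fun z => L x z (p, q)) f g (proj1 (HL x _ _ Hj))).
Qed.

(** The Euler-Lagrange equation only speaks of the value of a derivative, which
    Derive has whether or not it exists; smoothness of L makes it a genuine one.
    Only on the domain is L_u' known in terms of d_f' L1 and d_f' L2: the jet of
    the solution stays there near x, which suffices to differentiate. *)
Lemma real_Euler_Lagrange (Omega : R * C * C -> Prop) (w L : complex_jet_fun)
    (w1 w2 : jet_fun) a b f g x :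
  (forall x f g p q, Omega (x, (f, g), (p, q)) ->
     w x (f, g) (p, q) = (w1 x f g p q, w2 x f g p q)) ->
  complex_Lagrangian Omega w L ->
  admissible Omega a b f g -> solves_system w1 w2 a b f g -> in_interval a b x ->
  is_derive (fun t => d_dp (re_part L) t (f t) (g t) (Derive f t) (Derive g t)) x
    (d_df (re_part L) x (f x) (g x) (Derive f x) (Derive g x)) /\
  is_derive (fun t => d_dp (im_part L) t (f t) (g t) (Derive f t) (Derive g t)) x
    (d_df (im_part L) x (f x) (g x) (Derive f x) (Derive g x)).
Proof.
  intros Hw (HL1 & HL2 & HLa & HEL) Hadm Hsol Hx.
  set (u := fun t => (f t, g t) : C).
  assert (Hode : solves_rCODE w a b u).
  { intros t Ht. destruct (Hsol t Ht) as [Hf Hg].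
    change (w t (u t) (deriv_RC u t)) with (w t (f t, g t) (Derive f t, Derive g t)).
    rewrite Hw by apply (Hadm t Ht).
    rewrite <- Hf, <- Hg. reflexivity. }
  assert (HE := proj2 (HEL a b u Hadm) Hode x Hx).
  change (deriv_RC u x) with (Derive f x, Derive g x) in HE.
  change (u x) with (f x, g x) in HE.
  destruct (Hadm x Hx) as (Hf & Hg & Hp & Hq & Hj).
  rewrite (proj1 (L_u_partials Omega L _ _ _ _ _ HLa Hj)) in HE.
  assert (Hloc : locally x (fun t => L_u' L t (u t) (deriv_RC u t) =
    (d_dp (re_part L) t (f t) (g t) (Derive f t) (Derive g t),
     d_dp (im_part L) t (f t) (g t) (Derive f t) (Derive g t)))).
  { apply (locally_interval _ x a b); [apply Hx | apply Hx |].
    intros t Hat Htb.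
    apply (L_u'_partials Omega L t (f t) (g t) (Derive f t) (Derive g t) HLa).
    apply Hadm; split; assumption. }
  unfold deriv_RC at 1 in HE.
  rewrite (Derive_ext_loc (fun t => Re (L_u' L t (u t) (deriv_RC u t)))
    (fun t => d_dp (re_part L) t (f t) (g t) (Derive f t) (Derive g t))) in HE
    by (revert Hloc; apply filter_imp; intros t Ht; exact (f_equal Re Ht)).
  rewrite (Derive_ext_loc (fun t => Im (L_u' L t (u t) (deriv_RC u t)))
    (fun t => d_dp (im_part L) t (f t) (g t) (Derive f t) (Derive g t))) in HE
    by (revert Hloc; apply filter_imp; intros t Ht; exact (f_equal Im Ht)).
  injection HE as HE1 HE2.
  assert (Hd : forall F, smooth Omega (on_jets F) ->
    ex_derive (fun t => d_dp F t (f t) (g t) (Derive f t) (Derive g t)) x).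
  { intros F HF. eexists.
    refine (is_derive_along_jet (d_dp F) f g (Derive f) (Derive g) x _ _ _ _ _ _ _ _ _).
    - exact (smooth_d_dp Omega F _ HF Hj).
    - apply Derive_correct, Hf.
    - apply Derive_correct, Hg.
    - apply Derive_correct, Hp.
    - apply Derive_correct, Hq. }
  split.
  - replace (d_df (re_part L) x (f x) (g x) (Derive f x) (Derive g x))
      with (Derive (fun t => d_dp (re_part L) t (f t) (g t) (Derive f t) (Derive g t)) x) by lra.
    exact (Derive_correct _ _ (Hd _ HL1)).
  - replace (d_df (im_part L) x (f x) (g x) (Derive f x) (Derive g x))
      with (Derive (fun t => d_dp (im_part L) t (f t) (g t) (Derive f t) (Derive g t)) x) by lra.
    exact (Derive_correct _ _ (Hd _ HL2)).
Qed.

(** * The first integrals *)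

(** Differentiation of I1 along a curve, with every ingredient replaced by its
    restriction to the curve: l1, l2 stand for the Lagrangians and P1, P2 for
    the momenta. *)
Lemma is_derive_noether_I1_curve
    (s1 s2 l1 l2 P1 P2 c1 c2 p q A : R -> R) x
    (ds1 ds2 dl1 dl2 dP1 dP2 dc1 dc2 dp dq dA : R) :
  is_derive s1 x ds1 -> is_derive s2 x ds2 -> is_derive l1 x dl1 -> is_derive l2 x dl2 ->
  is_derive P1 x dP1 -> is_derive P2 x dP2 -> is_derive c1 x dc1 -> is_derive c2 x dc2 ->
  is_derive p x dp -> is_derive q x dq -> is_derive A x dA ->
  is_derive (fun t => s1 t * l1 t - s2 t * l2 t
      + P1 t * (c1 t - p t * s1 t + q t * s2 t)
      - P2 t * (c2 t - p t * s2 t - q t * s1 t) - A t) x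
    (ds1 * l1 x + s1 x * dl1 - (ds2 * l2 x + s2 x * dl2)
     + (dP1 * (c1 x - p x * s1 x + q x * s2 x)
        + P1 x * (dc1 - (dp * s1 x + p x * ds1) + (dq * s2 x + q x * ds2)))
     - (dP2 * (c2 x - p x * s2 x - q x * s1 x)
        + P2 x * (dc2 - (dp * s2 x + p x * ds2) - (dq * s1 x + q x * ds1)))
     - dA).
Proof.
  intros.
  auto_derive.
  - repeat split; eexists; eassumption.
  - repeat match goal with
      | H : is_derive ?h x ?d |- _ => replace (Derive (fun t : R => h t) x) with d
          by (symmetry; exact (is_derive_unique h x d H)); clear H
      end.
    ring.
Qed.

(** I2 is I1 for the Lagrangian - i L, whose real and imaginary parts are L2
    and - L1, as Im z = Re (- i z). *)
Lemma is_derive_noether_I2_curve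
    (s1 s2 l1 l2 P1 P2 c1 c2 p q A : R -> R) x
    (ds1 ds2 dl1 dl2 dP1 dP2 dc1 dc2 dp dq dA : R) :
  is_derive s1 x ds1 -> is_derive s2 x ds2 -> is_derive l1 x dl1 -> is_derive l2 x dl2 ->
  is_derive P1 x dP1 -> is_derive P2 x dP2 -> is_derive c1 x dc1 -> is_derive c2 x dc2 ->
  is_derive p x dp -> is_derive q x dq -> is_derive A x dA ->
  is_derive (fun t => s1 t * l2 t + s2 t * l1 t
      + P2 t * (c1 t - p t * s1 t + q t * s2 t)
      + P1 t * (c2 t - p t * s2 t - q t * s1 t) - A t) x
    (ds1 * l2 x + s1 x * dl2 + (ds2 * l1 x + s2 x * dl1)
     + (dP2 * (c1 x - p x * s1 x + q x * s2 x)
        + P2 x * (dc1 - (dp * s1 x + p x * ds1) + (dq * s2 x + q x * ds2)))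
     + (dP1 * (c2 x - p x * s2 x - q x * s1 x)
        + P1 x * (dc2 - (dp * s2 x + p x * ds2) - (dq * s1 x + q x * ds1)))
     - dA).
Proof.
  intros Hs1 Hs2 Hl1 Hl2 HP1 HP2 Hc1 Hc2 Hp Hq HA.
  assert (H := is_derive_noether_I1_curve s1 s2 l2 (fun t => - l1 t) P2 (fun t => - P1 t)
    c1 c2 p q A x _ _ _ _ _ _ _ _ _ _ _ Hs1 Hs2 Hl2 (is_derive_opp _ _ _ Hl1)
    HP2 (is_derive_opp _ _ _ HP1) Hc1 Hc2 Hp Hq HA).
  refine (eq_ind _ (is_derive _ x) (is_derive_ext _ _ _ _ _ H) _ _).
  - intros t. simpl. ring.
  - unfold opp; simpl. ring.
Qed.

Theorem mainTheorem2
  (Omega : R * C * C -> Prop) (w L : R -> C -> C -> C)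
  (w1 w2 L1 L2 : R -> R -> R -> R -> R -> R)
  (s1 s2 c1 c2 A1 A2 : R -> R -> R -> R)
  (HOmega : open Omega)
  (Hw : forall x f g p q, Omega (x, (f, g), (p, q)) ->
     w x (f, g) (p, q) = (w1 x f g p q, w2 x f g p q))
  (HL12 : forall x f g p q, L x (f, g) (p, q) = (L1 x f g p q, L2 x f g p q))
  (HL : complex_Lagrangian Omega w L)
  (HN : Noether_like Omega L1 L2 s1 s2 c1 c2 A1 A2) :
  first_integral Omega w1 w2 (noether_I1 L1 L2 s1 s2 c1 c2 A1) /\
  first_integral Omega w1 w2 (noether_I2 L1 L2 s1 s2 c1 c2 A2).
Proof.
  (* L1 and L2 are the two parts of L as functions, so that their derivatives
     agree with those of the parts of L. *)
  assert (E1 : L1 = re_part L)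
    by (repeat (apply functional_extensionality; intro); unfold re_part;
        rewrite HL12; reflexivity).
  assert (E2 : L2 = im_part L)
    by (repeat (apply functional_extensionality; intro); unfold im_part;
        rewrite HL12; reflexivity).
  subst L1 L2; clear HL12.
  destruct HN as (Hs1 & Hs2 & Hc1 & Hc2 & HA1 & HA2 & HN).
  split; intros a b f g Hadm Hsol x Hx;
    destruct (real_Euler_Lagrange Omega w L w1 w2 a b f g x Hw HL Hadm Hsol Hx)
      as [HE1 HE2];
    destruct HL as (HL1 & HL2 & HLa & _);
    destruct (Hadm x Hx) as (Hf & Hg & Hp & Hq & Hj);
    destruct (HN _ _ _ _ _ Hj) as [HN1 HN2];
    destruct (L_u_partials Omega L _ _ _ _ _ HLa Hj) as (_ & CRf1 & CRf2);
    destruct (L_u'_partials Omega L _ _ _ _ _ HLa Hj) as (_ & CRp1 & CRp2);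
    apply Derive_correct in Hf, Hg, Hp, Hq;
    assert (Hb : base_of Omega (x, (f x, g x))) by (eexists; exact Hj);
    assert (HdL1 := is_derive_along_jet _ _ _ _ _ _ _ _ _ _
      (smooth_ex_filterdiff _ _ _ HL1 Hj) Hf Hg Hp Hq);
    assert (HdL2 := is_derive_along_jet _ _ _ _ _ _ _ _ _ _
      (smooth_ex_filterdiff _ _ _ HL2 Hj) Hf Hg Hp Hq);
    assert (Hds1 := is_derive_along_base s1 _ _ _ _ _ (smooth_ex_filterdiff _ _ _ Hs1 Hb) Hf Hg);
    assert (Hds2 := is_derive_along_base s2 _ _ _ _ _ (smooth_ex_filterdiff _ _ _ Hs2 Hb) Hf Hg);
    assert (Hdc1 := is_derive_along_base c1 _ _ _ _ _ (smooth_ex_filterdiff _ _ _ Hc1 Hb) Hf Hg);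
    assert (Hdc2 := is_derive_along_base c2 _ _ _ _ _ (smooth_ex_filterdiff _ _ _ Hc2 Hb) Hf Hg);
    assert (HdA1 := is_derive_along_base A1 _ _ _ _ _ (HA1 _ Hb) Hf Hg);
    assert (HdA2 := is_derive_along_base A2 _ _ _ _ _ (HA2 _ Hb) Hf Hg).
  - assert (H := is_derive_noether_I1_curve _ _ _ _ _ _ _ _ _ _ _ x _ _ _ _ _ _ _ _ _ _ _
      Hds1 Hds2 HdL1 HdL2 HE1 HE2 Hdc1 Hdc2 Hp Hq HdA1).
    refine (@eq_ind R _ (fun d => is_derive _ x d) H _ _); clear H.
    (* Once Cauchy-Riemann has removed the derivatives in g and g', the terms in
       f'' and g'' cancel and the Noether condition gives the gauge term. *)
    unfold X1_prol, X2_prol, chi1_prol, chi2_prol in HN1.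
    rewrite CRf1, CRf2, CRp1, CRp2 in HN1.
    rewrite CRf1, CRf2, CRp1, CRp2, <- HN1.
    field.
  - assert (H := is_derive_noether_I2_curve _ _ _ _ _ _ _ _ _ _ _ x _ _ _ _ _ _ _ _ _ _ _
      Hds1 Hds2 HdL1 HdL2 HE1 HE2 Hdc1 Hdc2 Hp Hq HdA2).
    refine (@eq_ind R _ (fun d => is_derive _ x d) H _ _); clear H.
    unfold X1_prol, X2_prol, chi1_prol, chi2_prol in HN2.
    rewrite CRf1, CRf2, CRp1, CRp2 in HN2.
    rewrite CRf1, CRf2, CRp1, CRp2, <- HN2.
    field.
Qed.
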